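(* Let $\mathcal S_1,\mathcal S_2$ be two control semigroups. If $f:X\to Y$ is a $\Sigma(\mathcal S_2)$-coarse function of metric spaces, then $$asdim_{\mathcal S_1}X\le asdim_{(\mathcal S_1,\mathcal S_2)}(f)+asdim_{\mathcal S_2}Y.$$
   Context: $\mathbb R_+=[0,\infty)$. A property $P(s)$ of positive reals holds in a neighborhood of $\infty$ if there is $s_0$ such that it holds for all $s\ge s_0$. An asymptotic (large scale) dim-control function is an increasing continuous $f:\mathbb R_+\to\mathbb R_+$ with $f(x)\ge x$ in a neighborhood of $\infty$ and $\lim_{x\to\infty}f(x)=\infty$; it is asymptotically linear if it equals some linear function in a neighborhood of $\infty$. A (large scale) control semigroup is a set $\mathcal S$ of asymptotic dim-control functions containing every asymptotically linear dim-control function and closed under composition. A family of subsets of a metric space is $s$-disjoint if $d(U,V)>s$ for any two distinct members $U,V$, and $C$-bounded if every member has diameter $\le C$. $asdim_{\mathcal S}X\le n$ means there is $f\in\mathcal S$ such that for every $s$ in some neighborhood of $\infty$ there is a cover $\mathcal U=\bigcup_{i=1}^{n+1}\mathcal U_i$ of $X$ with each $\mathcal U_i$ $s$-disjoint and $f(s)$-bounded; $asdim_{\mathcal S}X$ is the least such $n$ ($\infty$ if none). $\Sigma(\mathcal S)$ is the set of all continuous increasing functions $\rho$ with $\lim_{x\to\infty}\rho(x)=\infty$ for which there is $g\in\mathcal S$ with $g\ge\rho$ in a neighborhood of $\infty$. A function $f:X\to Y$ of metric spaces is $\Sigma(\mathcal S)$-coarse if there is $\rho\in\Sigma(\mathcal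 S)$ with $d_Y(f(x),f(y))\le\rho(d_X(x,y))$ for all $x,y\in X$. A function $D:\mathbb R_+\times\mathbb R_+\to\mathbb R_+$ is an $(\mathcal S_1,\mathcal S_2)$-function if for every $\rho_1\in\mathcal S_1$ and every $\delta\in\mathcal S_2$ there is $\rho_2\in\mathcal S_1$ such that $D(\rho_1(x),\delta(x))\le\rho_2(x)$ in a neighborhood of $\infty$. Given $f:X\to Y$, a subset $A\subset X$ is $(\infty,R)$-bounded if $d_Y(f(x),f(y))\le R$ for all $x,y\in A$. The $r$-components of a subset $B$ of a metric space are the equivalence classes of points of $B$ that can be joined by a finite chain in $B$ with consecutive points at distance $\le r$. For $m\ge0$, an $m$-dimensional $(\mathcal S_1,\mathcal S_2)$-control function of $f$ is an $(\mathcal S_1,\mathcal S_2)$-function $D_f$ such that for all $r_X>0$ and $R_Y>0$ in a neighborhood of $\infty$, any $(\infty,R_Y)$-bounded subset $A$ of $X$ can be expressed as the union of $m+1$ sets whose $r_X$-components are $D_f(r_X,R_Y)$-bounded (have diameter at most $D_f(r_X,R_Y)$). $asdim_{(\mathcal S_1,\mathcal S_2)}(f)$ is the minimum $m$ for which there is an $m$-dimensional $(\mathcal S_1,\mathcal S_2)$-control function of $f$ ($\infty$ if none). *)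

(* Defs.v *)
From mathcomp Require Import all_boot all_order all_algebra.
From mathcomp Require Import all_classical all_reals.
From mathcomp Require Import ereal topology normedtype.

Set Implicit Arguments.
Unset Strict Implicit.
Unset Printing Implicit Defensive.

Import Order.TTheory GRing.Theory Num.Theory.
Import numFieldNormedType.Exports.

Local Open Scope classical_set_scope.
Local Open Scope ring_scope.

(* Functions [0, +oo[ -> [0, +oo[ are encoded as functions R -> R whose values
   on negative arguments are irrelevant. *)

Section control_functions.
Variable R : realType.
Implicit Types (f g rho : R -> R) (S : set (R -> R)).

Definition maps_nneg f := forall x, 0 <= x -> 0 <= f x.

(* "Increasing" means strictly increasing, as in [increasing_fun]. *)
Definition proper_increasing f :=
  [/\ maps_nneg f,
      {in `[0, +oo[ &, {homo f : x y / x < y}},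
      {within `[0, +oo[, continuous f} &
      f x @[x --> +oo] --> +oo].

Definition dim_control f :=
  proper_increasing f /\ \forall x \near +oo, x <= f x.

(* "Linear" is taken without a constant term.  A control semigroup has to
   contain all asymptotically linear functions, so this asks for less than
   allowing affine functions would. *)
Definition asymptotically_linear f :=
  exists a : R, \forall x \near +oo, f x = a * x.

Definition control_semigroup S :=
  [/\ forall f, S f -> dim_control f,
      forall f, dim_control f -> asymptotically_linear f -> S f &
      forall f g, S f -> S g -> S (f \o g)].

Definition Sigma S : set (R -> R) :=
  [set rho | proper_increasing rho /\
             exists2 g, S g & \forall x \near +oo, rho x <= g x].

Definition control_pair_function (S1 S2 : set (R -> R)) (D : R -> R -> R) :=
  (forall x y, 0 <= x -> 0 <= y -> 0 <= D x y) /\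
  forall rho1 delta, S1 rho1 -> S2 delta ->
    exists2 rho2, S1 rho2 &
      \forall x \near +oo, D (rho1 x) (delta x) <= rho2 x.

Definition least_nat (P : nat -> Prop) : \bar R :=
  match pselect (exists n, `[< P n >]) with
  | left exP => (ex_minn exP)%:R%:E
  | right _ => +oo%E
  end.

End control_functions.

Section metric_notions.
Variables (R : realType) (X : metricType R).
Implicit Types (A B U V : set X) (F : set (set X)) (r s C : R).

Definition set_dist U V : \bar R :=
  ereal_inf [set e | exists x y, [/\ U x, V y & e = (mdist x y)%:E]].

Definition diam U : \bar R :=
  ereal_sup [set e | exists x y, [/\ U x, U y & e = (mdist x y)%:E]].

Definition disjoint_family s F :=
  forall U V, F U -> F V -> U <> V -> (s%:E < set_dist U V)%E.

Definition bounded_family C F := forall U, F U -> (diam U <= C%:E)%E.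

Definition component_of r B (x : X) : set X :=
  [set y | exists p : seq X,
     path (fun a b => (b \in B) && (mdist a b <= r)) x p /\ last x p = y].

Definition components r B : set (set X) :=
  [set component_of r B x | x in B].

Definition asdim_le (S : set (R -> R)) (n : nat) :=
  exists2 f, S f & \forall s \near +oo,
    exists F : 'I_n.+1 -> set (set X),
      \bigcup_i \bigcup_(U in F i) U = setT /\
      forall i, disjoint_family s (F i) /\ bounded_family (f s) (F i).

Definition asdim (S : set (R -> R)) : \bar R := least_nat R (asdim_le S).

End metric_notions.

Section maps.
Variables (R : realType) (X Y : metricType R) (f : X -> Y).
Implicit Types S : set (R -> R).

Definition Sigma_coarse S :=
  exists2 rho, Sigma S rho &
    forall x y : X, mdist (f x) (f y) <= rho (mdist x y).

Definition fiber_bounded (r : R) (A : set X) :=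
  forall x y, A x -> A y -> mdist (f x) (f y) <= r.

Definition map_control_function S1 S2 (m : nat) (D : R -> R -> R) :=
  control_pair_function S1 S2 D /\
  \forall rX & rY \near +oo, forall A : set X, fiber_bounded rY A ->
    exists B : 'I_m.+1 -> set X,
      A = \bigcup_i B i /\
      forall i, bounded_family (D rX rY) (components rX (B i)).

Definition asdim_map S1 S2 : \bar R :=
  least_nat R (fun m => exists D, map_control_function S1 S2 m D).

End maps.

Arguments asdim {R} X S.
Arguments asdim_le {R} X S n.

(* Main.v *)
(** Color Y by n+1 colors at a large scale and add the preimages of the color
    classes one at a time.  If P carries a coloring by N colors, and Q splits
    into far apart pieces whose neighborhoods carry colorings by M <= N+1
    colors at a scale exceeding the bound D for the coloring of P, then a
    mapping cylinder construction colors the union of P and Q by N+1 colors: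
    each piece of P is cut off near Q and what is cut off is absorbed into a
    nearby piece of Q, at a distance to Q that depends on the color, so that
    only one color changes at a time.  Starting from the empty set with m
    colors, n+1 steps give m+n+1 colors. *)
Require Import Defs.
From mathcomp Require Import all_boot all_order all_algebra.
From mathcomp Require Import all_classical all_reals.
From mathcomp Require Import ereal topology normedtype.
From mathcomp Require Import lra zify.

Import Order.TTheory GRing.Theory Num.Theory.
Import numFieldNormedType.Exports.

Local Open Scope classical_set_scope.
Local Open Scope ring_scope.

(* [c] is the color and [b] the name of the piece within the color class; this
   replaces r-components, with pieces of diameter at most [D]. *)
Definition colorable {R : realType} {X : metricType R} (N : nat) (r D : R)
    (A : set X) :=
  exists (c : X -> nat) (b : X -> set X),
    [/\ forall x, A x -> (c x < N)%N,
        forall x y, A x -> A y -> c x = c y -> mdist x y <= r -> b x = b y &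
        forall x y, A x -> A y -> c x = c y -> b x = b y -> mdist x y <= D].

(** * Colorings from covers of bounded multiplicity *)

(** The least [c] with [k c <= c] is some [j.+1]. Minimality and monotonicity squeeze
    [j.+1 <= k j <= k j.+1 <= j.+1]. *)
Lemma fixed_value_step (k : nat -> nat) (N : nat) :
  (0 < k 0)%N -> (k N <= N)%N -> {homo k : i j / (i <= j)%N} ->
  exists2 j, (j < N)%N & k j = j.+1 /\ k j.+1 = j.+1.
Proof.
move=> k0 kN kmono.
have ex : exists c, (k c <= c)%N by exists N.
case: (ex_minnP ex) => [[|j]] kj jmin; first by lia.
have jN : (j < N)%N by exact: jmin.
have kj' : (j < k j)%N.
  by rewrite ltnNge; apply/negP => /jmin; rewrite ltnn.
exists j => //; have := kmono j j.+1 (leqnSn j); lia.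
Qed.

(* The points of color j are those x for which exactly j + 1 members of the
   cover come within j s of x and no further member comes within (j + 1) s;
   the set of these members is then constant along s-chains of color j. *)
Lemma colorable_of_multiplicity {R : realType} {X : metricType R} (I : eqType)
    (W : I -> set X) (A : set X) (N : nat) (s D : R) :
  0 <= s ->
  (forall x, A x -> exists i, W i x) ->
  (forall i x y, W i x -> W i y -> mdist x y <= D) ->
  (forall x, A x -> exists L : seq I, (size L <= N)%N /\
     forall i y, W i y -> mdist x y <= N%:R * s -> i \in L) ->
  colorable N s (D + N%:R * s) A.
Proof.
move=> s0 cover bnd mult.
have /choice[L LP] : forall x, exists L : seq I, A x ->
    (size L <= N)%N /\ forall i y, W i y -> mdist x y <= N%:R * s -> i \in L.
  move=> x; have [/mult[L LP]|nAx] := pselect (A x); first by exists L.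
  by exists [::].
pose T x (t : nat) : set I := [set i | exists2 y, W i y & mdist x y <= t%:R * s].
pose F x t := [seq i <- undup (L x) | `[<T x t i>]].
have TS x t u : (t <= u)%N -> T x t `<=` T x u.
  move=> tu i [y Wy xy]; exists y => //; apply: le_trans xy _.
  by rewrite ler_wpM2r // ler_nat.
have FE x t i : A x -> (t <= N)%N -> (i \in F x t) = `[<T x t i>].
  move=> Ax tN; rewrite mem_filter mem_undup andb_idr // => /asboolP.
  by move=> /(TS _ _ _ tN)[y Wy xy]; exact: (LP x Ax).2 Wy xy.
have Fu x t : uniq (F x t) by rewrite filter_uniq // undup_uniq.
have /choice[j jP] : forall x, exists j, A x ->
    [/\ (j < N)%N, size (F x j) = j.+1 & size (F x j.+1) = j.+1].
  move=> x; have [Ax|nAx] := pselect (A x); last by exists 0%N.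
  have [||t u tu|j jN [Fj Fj1]] := @fixed_value_step (fun t => size (F x t)) N.
  - have [i Wi] := cover x Ax.
    have : i \in F x 0%N by rewrite FE //; apply/asboolP; exists x; rewrite // mdistxx mul0r.
    by case: (F x 0%N).
  - rewrite (leq_trans _ (LP x Ax).1) // size_filter (leq_trans (count_size _ _)) //.
    exact: size_undup.
  - apply: uniq_leq_size => // i; rewrite !mem_filter => /andP[/asboolP Ti ->].
    by rewrite andbT; apply/asboolP; exact: TS Ti.
  by exists j.
have sub x y : A x -> A y -> j x = j y -> mdist x y <= s ->
    T x (j x).+1 `<=` T y (j y).+1.
  move=> Ax Ay jxy xy i Ti; have [jN Fj Fj1] := jP x Ax.
  (* No new member appears between radius [j s] and [(j + 1) s]. So a member seen from [x] at the
     larger radius is already met within [j s], which leaves room for the move to [y]. *)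
  have [_ FE'] : (size (F x (j x)) = size (F x (j x).+1)) * (F x (j x) =i F x (j x).+1).
    apply: uniq_min_size => //; last by rewrite Fj Fj1.
    move=> k; rewrite !FE // 1?ltnW // => /asboolP Tk; apply/asboolP; exact: TS Tk.
  have : i \in F x (j x) by rewrite FE' FE //; apply/asboolP.
  rewrite FE 1?ltnW // => /asboolP[z Wz xz]; exists z => //.
  rewrite (le_trans (metric_triangle y x z)) // (metric_sym y x) -jxy.
  by rewrite -natr1 mulrDl mul1r addrC lerD.
(* A piece name must be a [set X], so an index set is encoded by the points that share it. As [x]
   lies in its own name, equal names give equal index sets. *)
exists j, (fun x => [set z | T z (j z).+1 = T x (j x).+1]); split=>
  [x /jP[]//|x y Ax Ay jxy xy|x y Ax Ay jxy bxy].
- suff -> : T x (j x).+1 = T y (j y).+1 by [].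
  by apply/seteqP; split; apply: sub => //; rewrite metric_sym.
- have [i Wi] := cover x Ax.
  have Txy : T x (j x).+1 = T y (j y).+1.
    by have : [set z | T z (j z).+1 = T x (j x).+1] x by []; rewrite bxy.
  have : T x (j x).+1 i.
    by exists x => //; rewrite mdistxx mulr_ge0.
  rewrite Txy => -[z Wz yz]; rewrite (le_trans (metric_triangle x z y)) //.
  rewrite lerD //; first exact: bnd Wi Wz.
  rewrite metric_sym (le_trans yz) // ler_wpM2r // ler_nat.
  by have [] := jP y Ay.
Qed.

(** * Union of two colored sets *)

(** Pigeonhole for multiplicity bounds: an element may fit several slots, but a slot has at most one
    occupant, so listing occupants suffices. *)
Lemma seq_of_slots (I : eqType) (S : set I) (n : nat) (slot : nat -> I -> Prop) :
  (forall i, S i -> exists2 k, (k < n)%N & slot k i) ->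
  (forall k i j, S i -> S j -> slot k i -> slot k j -> i = j) ->
  exists L : seq I, (size L <= n)%N /\ forall i, S i -> i \in L.
Proof.
move=> slotS slotI.
have /choice[o oP] : forall k, exists o : option I,
    forall i, S i -> slot k i -> o = Some i.
  move=> k; have [[i [Si ki]]|no] := pselect (exists i, S i /\ slot k i).
    by exists (Some i) => j Sj kj; congr Some; exact: slotI kj.
  by exists None => i Si ki; case: no; exists i.
exists (pmap o (iota 0 n)); split.
  by rewrite size_pmap -{2}(size_iota 0 n) count_size.
move=> i Si; have [k kn ki] := slotS i Si.
rewrite mem_pmap -(oP k i Si ki); apply: map_f.
by rewrite mem_iota.
Qed.

(* Cover by the pieces (l, beta) of P, kept at distance more than [th l] of Q,
   and by the pieces (w, k, beta) of the neighborhoods [A w]; the rest of a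
   piece u of P near [A w] joins the piece of one selected point of u in [A w].
   A [tau]-ball close to Q meets at most M members, all of the second kind.
   Away from Q, each color of P gives one member, except at most one color l
   giving two, as the thresholds [th l] are [2 * tau] apart. *)
Lemma colorable_union {R : realType} {X : metricType R} (V : Type)
    (P Q : set X) (v : X -> V) (N M : nat) (s r D r' D' : R) :
  let tau := N.+1%:R * s in
  let t := (2 * N.+1)%:R * tau in
  0 <= s -> 0 <= D -> 0 <= D' -> (M <= N.+1)%N ->
  2 * tau <= r -> 2 * (D + tau) <= r' ->
  colorable N r D P ->
  (forall x y, Q x -> Q y -> mdist x y <= 2 * t -> v x = v y) ->
  (forall w, colorable M r' D' [set x | exists q, [/\ Q q, v q = w & mdist x q <= t]]) ->
  colorable N.+1 s (D' + 2 * D + tau) (P `|` Q).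
Proof.
move=> tau t s0 D0 D'0 MN taur Dr' [c [b [cN bc bD]]] Qsep Aw.
have tau0 : 0 <= tau by rewrite mulr_ge0.
have t0 : 0 <= t by rewrite mulr_ge0.
pose A w := [set x | exists q, [/\ Q q, v q = w & mdist x q <= t]].
have /choice[cb cbP] : forall w, exists cb : (X -> nat) * (X -> set X),
   [/\ forall x, A w x -> (cb.1 x < M)%N,
       forall x y, A w x -> A w y -> cb.1 x = cb.1 y -> mdist x y <= r' ->
         cb.2 x = cb.2 y &
       forall x y, A w x -> A w y -> cb.1 x = cb.1 y -> cb.2 x = cb.2 y ->
         mdist x y <= D'].
  by move=> w; have [c' [b' ?]] := Aw w; exists (c', b').
pose sel w l beta := [set z | [/\ P z, A w z, c z = l & b z = beta]].
(* One selected point per [w] and piece of [P] sends everything cut off from that piece near [A w]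
   to a single piece of [A w]. *)
have /choice[pick pickP] : forall u : V * nat * set X, exists o : option X,
    if o is Some z then sel u.1.1 u.1.2 u.2 z else sel u.1.1 u.1.2 u.2 = set0.
  move=> u; have [[z uz]|no] := pselect (exists z, sel u.1.1 u.1.2 u.2 z).
    by exists (Some z).
  by exists None; apply/seteqP; split => // z uz; case: no; exists z.
(* The thresholds start at [2 * tau], and those of the colors below [N] stay [2 * tau] below [t]. *)
pose th l := (2 * l.+1)%:R * tau.
have thS l : th l.+1 = th l + 2 * tau.
  by rewrite /th (_ : 2 * l.+2 = 2 * l.+1 + 2)%N ?natrD ?mulrDl //; lia.
have th_ge l : 2 * tau <= th l by rewrite ler_wpM2r // ler_nat; lia.
have thN l : (l < N)%N -> th l + 2 * tau <= t.
  by rewrite -thS => lN; rewrite ler_wpM2r // ler_nat; lia.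
pose inP w x z := [/\ P x, exists q, [/\ Q q, v q = w & mdist x q <= th (c x)] &
   pick (w, c x, b x) = Some z].
pose I := ((nat * set X) + (V * nat * set X))%type.
pose W (i : {classic I}) : set X := match i : I with
  | inl (l, beta) =>
    [set x | [/\ P x, c x = l, b x = beta & forall q, Q q -> th l < mdist x q]]
  | inr (w, k, beta) =>
    [set x | exists z, [/\ A w z, (cb w).1 z = k, (cb w).2 z = beta &
       [/\ Q x, v x = w & z = x] \/ inP w x z]]
  end.
have QA x : Q x -> A (v x) x by move=> Qx; exists x; rewrite mdistxx.
have inPD w x z : inP w x z -> mdist x z <= D.
  move=> [Px _ pz]; have := pickP (w, c x, b x); rewrite pz /= => -[Pz _ cz bz].
  exact: bD.
have inrQ w k beta x : W (inr (w, k, beta)) x ->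
    exists q, [/\ Q q, v q = w & mdist x q + 2 * tau <= t].
  move=> /= [z [_ _ _ [[Qx vx _]|[Px [q [Qq vq xq]] _]]]].
    exists x; rewrite mdistxx add0r; split=> //.
    by rewrite ler_wpM2r // ler_nat; lia.
  exists q; split=> //; apply: le_trans (thN _ (cN _ Px)).
  by rewrite lerD2r.
have inrw x y y' w k beta w' k' beta' : mdist x y <= tau -> mdist x y' <= tau ->
    W (inr (w, k, beta)) y -> W (inr (w', k', beta')) y' -> w = w'.
  (* The two points of [Q] are at most [2 * (t - 2 * tau) + 2 * tau <= 2 * t] apart. *)
  move=> xy xy' /inrQ[q [Qq <- yq]] /inrQ[q' [Qq' <- yq']]; apply: Qsep => //.
  have := metric_triangle q x q'; have := metric_triangle x y q.
  have := metric_triangle x y' q'; rewrite (metric_sym q x); lra.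
apply: (@colorable_of_multiplicity _ _ _ W) => //.
- move=> x PQx; have [Qx|nQx] := pselect (Q x).
    exists (inr (v x, (cb (v x)).1 x, (cb (v x)).2 x)); exists x; split=> //.
      exact: QA.
    by left.
  case: PQx => // Px.
  have [[q [Qq xq]]|far] := pselect (exists q, Q q /\ mdist x q <= th (c x)); last first.
    exists (inl (c x, b x)); split=> // q Qq; rewrite ltNge; apply/negP => xq.
    by apply: far; exists q.
  have Ax : A (v q) x.
    by exists q; split=> //; have := thN _ (cN _ Px); lra.
  (* The value [None] is impossible, since [x] itself is eligible. *)
  have := pickP (v q, c x, b x); case E : (pick _) => [z|] /=.
    move=> [Pz Az cz bz].
    exists (inr (v q, (cb (v q)).1 z, (cb (v q)).2 z)); exists z; split=> //.
    by right; split=> //; exists q.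
  by move=> /seteqP[/(_ x) + _]; case.
- move=> [[l beta]|[[w k] beta]] x y /=.
    move=> [Px cx bx _] [Py cy by_ _].
    have : mdist x y <= D by apply: bD => //; rewrite ?cx ?bx.
    lra.
  have near z x' : [/\ Q x', v x' = w & z = x'] \/ inP w x' z -> mdist x' z <= D.
    by move=> [[_ _ ->]|/inPD//]; rewrite mdistxx.
  move=> [z [Az cz bz /near xz]] [z' [Az' cz' bz' /near yz']].
  have [_ _ /(_ z z' Az Az')] := cbP w.
  rewrite cz cz' bz bz' => /(_ erefl erefl) zz'.
  have := metric_triangle x z y; have := metric_triangle z z' y.
  rewrite (metric_sym z' y); lra.
- move=> x _.
  pose S : set {classic I} := [set i | exists2 y, W i y & mdist x y <= tau].
  suff [L [LN LS]] : exists L : seq {classic I}, (size L <= N.+1)%N /\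
      forall i, S i -> i \in L.
    by exists L; split=> // i y Wy xy; apply: LS; exists y.
  have [[q [Qq xq]]|far] := pselect (exists q, Q q /\ mdist x q <= tau).
  + have ninl l beta : ~ S (inl (l, beta)).
      move=> [y [_ _ _ /(_ _ Qq)] + xy]; have := th_ge l.
      have := metric_triangle y x q; rewrite (metric_sym y x); lra.
    (* Here a slot is a color of [A w]. Two members in one slot share [w], and their points [z],
       [z'] are within [2 * (D + tau) <= r'], hence in one piece. *)
    pose slot k (i : {classic I}) := if (i : I) is inr (w, k', beta) then k = k' else False.
    apply: (@seq_of_slots _ _ _ slot).
      move=> [[l beta] /ninl//|[[w k] beta] [y [z [Az cz _ _]] _]].
      exists k => //; rewrite (leq_trans _ MN) // -cz.
      by have [+ _ _] := cbP w; apply.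
    move=> k [[l beta] /ninl//|[[w k1] beta]] [[l' beta'] _ /ninl//|[[w' k2] beta']].
    move=> [y Wy xy] [y' Wy' xy'] /= k1E k2E; subst k1 k2.
    have ww' := inrw _ _ _ _ _ _ _ _ _ xy xy' Wy Wy'; subst w'.
    move: Wy Wy' => [z [Az cz bz yz]] [z' [Az' cz' bz' yz']].
    congr (inr (_, _, _)); rewrite -bz -bz'.
    have near z1 x' : [/\ Q x', v x' = w & z1 = x'] \/ inP w x' z1 -> mdist x' z1 <= D.
      by move=> [[_ _ ->]|/inPD//]; rewrite mdistxx.
    have [_ + _] := cbP w; apply=> //; first by rewrite cz cz'.
    move: (near _ _ yz) (near _ _ yz').
    have := metric_triangle z y z'; have := metric_triangle y x z'.
    have := metric_triangle x y' z'; rewrite (metric_sym z y) (metric_sym y x); lra.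
  (* What remains of color [l] uses slot [l], and what is absorbed uses slot [l.+1]. The [N.+1]
     slots suffice because an absorbed part of color [l] and a remaining part of color [l.+1] never
     meet the same ball. *)
  + pose slot k (i : {classic I}) := match i : I with
      | inl (l, _) => k = l
      | inr (w, k', beta) => exists y z, [/\ mdist x y <= tau, inP w y z,
           (cb w).1 z = k', (cb w).2 z = beta & k = (c y).+1]
      end.
    apply: (@seq_of_slots _ _ _ slot).
      move=> [[l beta]|[[w k] beta]] [y] => [[Py <- _ _] _|[z [_ cz bz]]].
        by exists (c y) => //; rewrite ltnW // ltnS cN.
      case=> [[Qy _ _] xy|yz xy]; first by case: far; exists y.
      exists (c y).+1; first by rewrite ltnS; case: yz => /cN.
      by exists y, z.
    (* The remaining part is farther than [th (c y') + 2 * tau] from [q], while [y'] is within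
       [th (c y')] of it, and a [tau]-ball cannot bridge this gap. *)
    have cross l beta y' w z' : S (inl (l, beta)) -> mdist x y' <= tau ->
        inP w y' z' -> l <> (c y').+1.
      move=> [y [_ _ _ yQ] xy] xy' [_ [q [Qq _ yq]] _] lE; subst l.
      move: (yQ _ Qq); rewrite thS; have := metric_triangle y x q.
      have := metric_triangle x y' q; rewrite (metric_sym y x); lra.
    move=> k [[l beta]|[[w k1] beta]] [[l' beta']|[[w' k2] beta']].
    * move=> [y [Py cy by_ _] xy] [y' [Py' cy' by' _] xy'] /= kl kl'.
      have ll' : l = l' by rewrite -kl -kl'.
      have -> : beta = beta'; last by rewrite ll'.
      rewrite -by_ -by'; apply: bc => //; first by rewrite cy cy'.
      have := metric_triangle y x y'; rewrite (metric_sym y x); lra.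
    * move=> Si _ /= -> [y [z [xy yz _ _ kE]]].
      by case: (cross _ _ _ _ _ Si xy yz).
    * move=> _ Si /= [y [z [xy yz _ _ ->]]] kE.
      by case: (cross _ _ _ _ _ Si xy yz).
    * move=> [u Wu xu] [u' Wu' xu'] [y [z [xy yz <- <- ->]]] [y' [z' [xy' yz' <- <- [cyy']]]].
      have ww' := inrw _ _ _ _ _ _ _ _ _ xu xu' Wu Wu'; subst w'.
      move: yz yz' => [Py _ pz] [Py' _ pz'].
      (* Same color and same piece of [P] mean the same argument of [pick], hence the same selected
         point. *)
      have bb : b y = b y'.
        apply: bc => //; have := metric_triangle y x y'; rewrite (metric_sym y x); lra.
      by move: pz; rewrite cyy' bb pz' => -[->].
Qed.

(** * Neighborhoods of infinity; colorings versus families and components *)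

Lemma near_pinftyW {R : realType} (P : R -> Prop) :
  (\forall x \near +oo, P x) -> exists M, forall x, M < x -> P x.
Proof. by case=> M [_ MP]; exists M. Qed.

Lemma near2_pinftyW {R : realType} (P : R -> R -> Prop) :
  (\forall x & y \near +oo, P x y) ->
  exists M, forall x y, M < x -> M < y -> P x y.
Proof.
case=> -[A B] /= [[M1 [_ AM1]] [M2 [_ BM2]]] AB.
exists (Num.max M1 M2) => x y; rewrite !gt_max => /andP[xM1 _] /andP[_ yM2].
by apply: (AB (x, y)); split; [exact: AM1|exact: BM2].
Qed.

Lemma set_dist_le {R : realType} {X : metricType R} {U V : set X} {x y : X} :
  U x -> V y -> (set_dist U V <= (mdist x y)%:E)%E.
Proof. by move=> Ux Vy; apply: ereal_inf_lbound; exists x, y. Qed.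

Lemma le_diam {R : realType} {X : metricType R} {U : set X} {x y : X} :
  U x -> U y -> ((mdist x y)%:E <= diam U)%E.
Proof. by move=> Ux Uy; apply: ereal_sup_ubound; exists x, y. Qed.

Lemma colorable_of_families {R : realType} {X : metricType R} (n : nat)
    (s D : R) (F : 'I_n -> set (set X)) :
  \bigcup_i \bigcup_(U in F i) U = setT ->
  (forall i, disjoint_family s (F i) /\ bounded_family D (F i)) ->
  colorable n s D [set: X].
Proof.
move=> cover FP.
have /choice[p pP] : forall x, exists p : 'I_n * set X, F p.1 p.2 /\ p.2 x.
  move=> x; have : [set: X] x by [].
  by rewrite -cover => -[i _ [U FU Ux]]; exists (i, U).
exists (fun x => (p x).1 : nat), (fun x => (p x).2).
split=> [x _|x y _ _ /val_inj pxy xys|x y _ _ /val_inj pxy bxy]; first exact: ltn_ord.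
- apply: contrapT => bxy; have [Fx xx] := pP x; have [Fy yy] := pP y.
  have [+ _] := FP (p x).1 => /(_ (p x).2 (p y).2 Fx).
  rewrite {1}pxy => /(_ Fy bxy)/lt_le_trans/(_ (set_dist_le xx yy)).
  by rewrite lte_fin ltNge xys.
- have [Fx xx] := pP x; have [_ yy] := pP y.
  have [_ /(_ _ Fx)] := FP (p x).1; rewrite -bxy in yy.
  by move/(le_trans (le_diam xx yy)); rewrite lee_fin.
Qed.

(** Points of distinct pieces of one color are more than [r] apart, but the infimum may equal [r];
    the gap [s < r] restores strictness. *)
Lemma families_of_colorable {R : realType} {X : metricType R} (n : nat)
    (s r D : R) : s < r -> colorable n r D [set: X] ->
  exists F : 'I_n -> set (set X),
    \bigcup_i \bigcup_(U in F i) U = setT /\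
    forall i, disjoint_family s (F i) /\ bounded_family D (F i).
Proof.
move=> sr [c [b [cn bc bD]]].
pose piece x := [set y | c y = c x /\ b y = b x].
exists (fun i => [set U | exists x, c x = i /\ U = piece x]); split.
  apply/seteqP; split=> // x _; exists (Ordinal (cn x I)) => //.
  by exists (piece x) => //; exists x.
move=> i; split.
- move=> U V [x [cx ->]] [y [cy ->]] UV.
  apply: (@lt_le_trans _ _ r%:E); first by rewrite lte_fin.
  apply: le_ereal_inf_tmp => _ [x' [y' [[cx' bx'] [cy' by'] ->]]].
  rewrite lee_fin leNgt; apply/negP => /ltW x'y'; apply: UV.
  have bxy : b x = b y.
    by rewrite -bx' -by'; apply: bc => //; rewrite cx' cy' cx cy.
  by rewrite /piece cx cy bxy.
- move=> U [x [cx ->]]; apply: ge_ereal_sup => _ [y [z [[cy by_] [cz bz] ->]]].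
  by rewrite lee_fin; apply: bD; rewrite ?cy ?cz ?by_ ?bz.
Qed.

Lemma component_of_near {R : realType} {X : metricType R} (r : R) (B : set X)
    (x y : X) : B x -> mdist x y <= r -> component_of r B x `<=` component_of r B y.
Proof.
move=> Bx xy z [p [px pz]]; exists (x :: p) => /=.
by rewrite px mem_set // metric_sym xy.
Qed.

Lemma colorable_of_components {R : realType} {X : metricType R} (n : nat)
    (r D : R) (A : set X) (B : 'I_n -> set X) :
  A = \bigcup_i B i ->
  (forall i, bounded_family D (components r (B i))) ->
  colorable n r D A.
Proof.
move=> AB BD.
(* An option is used because ['I_n] may be empty, leaving no default color outside [A]. *)
have /choice[i iP] : forall x, exists o : option 'I_n,
    A x -> if o is Some i then B i x else False.
  move=> x; have [Ax|nAx] := pselect (A x); last by exists None.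
  by move: (Ax); rewrite AB => -[i _ Bx]; exists (Some i).
pose c x := if i x is Some k then k : nat else 0%N.
pose b x := if i x is Some k then component_of r (B k) x else set0.
exists c, b; split.
- by move=> x /iP; rewrite /c; case: (i x).
- move=> x y /iP + /iP; rewrite /c /b; case: (i x) => // k; case: (i y) => // l.
  move=> Bx By /val_inj kl xy; rewrite -kl in By *.
  by apply/seteqP; split; apply: component_of_near; rewrite // metric_sym.
- move=> x y /iP + /iP; rewrite /c /b; case: (i x) => // k; case: (i y) => // l.
  move=> Bx By /val_inj kl bxy; rewrite -kl in By bxy.
  rewrite -lee_fin (le_trans _ (BD k (component_of r (B k) x) _)) //; last by exists x.
  by apply: le_diam; [exists [::]|rewrite bxy; exists [::]].
Qed.

Lemma least_nat_le {R : realType} (P : nat -> Prop) (n : nat) :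
  P n -> (least_nat R P <= n%:R%:E)%E.
Proof.
move=> Pn; rewrite /least_nat; case: pselect => [exP|[]]; last first.
  by exists n; apply/asboolP.
by rewrite lee_fin ler_nat; case: ex_minnP => k _; apply; apply/asboolP.
Qed.

Lemma least_natP {R : realType} (P : nat -> Prop) :
  (exists2 n, P n & least_nat R P = n%:R%:E) \/ least_nat R P = +oo%E.
Proof.
rewrite /least_nat; case: pselect => [exP|_]; last by right.
by left; case: ex_minnP => n /asboolP Pn _; exists n.
Qed.

(** * Calculus of control semigroups *)

Section control_semigroup_theory.
Context {R : realType} (S : set (R -> R)) (hS : control_semigroup S).

Lemma semigroup_scale (a : R) : 1 <= a -> S (fun x => a * x).
Proof.
move=> a1; have a0 : 0 < a by rewrite (lt_le_trans _ a1).
have [_ + _] := hS; apply; last by exists a; apply: nearW.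
split; last first.
  by near=> x; rewrite ler_peMl //; near: x; exact: nbhs_pinfty_ge.
split.
- by move=> x x0; rewrite mulr_ge0 // ltW.
- by move=> x y _ _ xy; rewrite ltr_pM2l.
- by apply: continuous_subspaceT => x; exact: mulrl_continuous.
- under eq_fun do rewrite mulrC.
  exact: (gt0_cvgMly a0 cvg_id).
Unshelve. all: by end_near.
Qed.

Lemma semigroup_comp g h : S g -> S h -> S (fun x => g (h x)).
Proof. by have [_ _ + Sg Sh] := hS; apply. Qed.

Lemma semigroup_le g : S g ->
  {in Num.nneg &, {homo g : x y / x <= y}}.
Proof.
move=> Sg x y; rewrite !nnegrE => x0 y0.
have [/(_ g Sg)[[_ gi _ _] _] _ _] := hS.
rewrite le_eqVlt => /orP[/eqP->//|xy]; apply/ltW/gi => //.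
  by rewrite in_itv /= x0.
by rewrite in_itv /= y0.
Qed.

Lemma semigroup_ge0 g x : S g -> 0 <= x -> 0 <= g x.
Proof. by have [+ _ _ Sg] := hS => /(_ g Sg)[[+ _ _ _] _]; apply. Qed.

Lemma semigroup_ge g : S g -> \forall x \near +oo, x <= g x.
Proof. by have [+ _ _ Sg] := hS => /(_ g Sg)[]. Qed.

(** Eventually [x <= g x], so [g] maps large arguments to large values. *)
Lemma semigroup_near g (P : R -> Prop) : S g ->
  (\forall x \near +oo, P x) -> \forall x \near +oo, P (g x).
Proof.
move=> Sg /near_pinftyW[M MP]; near=> x; apply: MP.
apply: (@lt_le_trans _ _ x); last by near: x; exact: semigroup_ge.
by near: x; apply: nbhs_pinfty_gt; exact: num_real.
Unshelve. all: by end_near.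
Qed.

(* There is no closure under sums; the composition dominates both terms. *)
Lemma semigroup_add g h : S g -> S h ->
  exists2 k, S k & \forall x \near +oo, g x + h x <= k x.
Proof.
move=> Sg Sh; exists (fun x => 2 * g (h x)).
  apply: (@semigroup_comp (fun x => 2 * x)); last exact: semigroup_comp.
  exact: semigroup_scale (ler1n _ 2).
near=> x.
have x0 : 0 <= x by near: x; exact: nbhs_pinfty_ge.
have xh : x <= h x by near: x; exact: semigroup_ge.
have hg : h x <= g (h x) by near: x; exact: (semigroup_near _ _ Sh (semigroup_ge _ Sg)).
have : g x <= g (h x).
  by apply: (semigroup_le _ Sg); rewrite ?nnegrE ?(le_trans x0 xh).
lra.
Unshelve. all: by end_near.
Qed.

End control_semigroup_theory.

(** * Coloring the preimages of the color classes of [Y] *)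

Lemma colorableW {R : realType} {X : metricType R} (N : nat) (r D D' : R)
    (A A' : set X) :
  A' `<=` A -> D <= D' -> colorable N r D A -> colorable N r D' A'.
Proof.
move=> A'A DD' [c [b [cN bc bD]]]; exists c, b; split.
- by move=> x /A'A /cN.
- by move=> x y /A'A Ax /A'A; exact: bc.
- by move=> x y /A'A Ax /A'A Ay cxy bxy; apply: le_trans DD'; exact: bD.
Qed.

(** The comparison of [rho] with [g] is only available for large arguments. Monotonicity of [rho]
    moves it to [t], so that short distances are covered too. *)
Lemma Sigma_coarse_bound {R : realType} {X Y : metricType R} (f : X -> Y)
    (S : set (R -> R)) : Sigma_coarse f S ->
  exists2 g, S g & \forall t \near +oo,
    forall x y, mdist x y <= t -> mdist (f x) (f y) <= g t.
Proof.
move=> [rho [[_ rho_incr _ _] [g Sg rhog]] frho]; exists g => //.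
near=> t => x y xyt; apply: le_trans (frho x y) _.
apply: (@le_trans _ _ (rho t)); last by near: t.
move: xyt; rewrite le_eqVlt => /orP[/eqP->//|xyt].
have t0 : 0 <= t by rewrite (le_trans _ (ltW xyt)) ?mdist_ge0.
by apply/ltW/rho_incr; rewrite // in_itv /= andbT // mdist_ge0.
Unshelve. all: by end_near.
Qed.

Section fibered_coloring.
Context {R : realType} (S1 S2 : set (R -> R)).
Hypotheses (hS1 : control_semigroup S1) (hS2 : control_semigroup S2).
Context {X Y : metricType R} (f : X -> Y) (m n : nat) (D : R -> R -> R).
Hypothesis fD : map_control_function f S1 S2 m D.
Variables (g gY : R -> R).
Hypotheses (Sg : S2 g) (SgY : S2 gY).
Hypothesis fg : \forall t \near +oo,
  forall x y : X, mdist x y <= t -> mdist (f x) (f y) <= g t.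

(* A coloring of Y is fixed at a scale large enough for all the scales of X
   met in the induction on j, where each step loses the factor C. *)
Lemma colorable_preimage (K : R) (c : R -> Y -> nat) (b : R -> Y -> set Y) :
  1 <= K ->
  (\forall s \near +oo,
     (forall x y, c s x = c s y -> mdist x y <= g (K * s) -> b s x = b s y) /\
     (forall x y, c s x = c s y -> b s x = b s y -> mdist x y <= gY (g (K * s)))) ->
  let C : R := (4 * (m + n).+1 ^ 2)%:R in
  forall j (kappa : R), (j <= n.+1)%N -> 1 <= kappa -> kappa * C ^+ j <= K ->
  exists2 h, S1 h & \forall s \near +oo,
    colorable (m + j) (kappa * s) (h s) [set x | (c s (f x) < j)%N].
Proof.
move=> K1 cb C.
have C1 : 1 <= C by rewrite /C ler1n muln_gt0 expn_gt0.
elim=> [|j IH] kappa jn k1 kK.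
  (* For [j = 0] the set to be colored is empty, so any bound in [S1] works. *)
  exists (fun x => 1 * x); first exact: semigroup_scale.
  by near=> s; exists (fun=> 0%N), (fun=> set0); split.
have k0 : 0 <= kappa by rewrite (le_trans _ k1).
have kCK : kappa * C * C ^+ j <= K by rewrite -mulrA -exprS.
have kC1 : 1 <= kappa * C by rewrite mulr_ege1.
have kCK' : kappa * C <= K.
  by rewrite (le_trans _ kCK) // ler_peMr ?exprn_ege1 // mulr_ge0 // (le_trans _ C1).
have [h Sh hP] := IH (kappa * C) (ltnW jn) kC1 kCK.
pose N := (m + j)%N.
have SN : S1 (fun s => N.+1%:R * kappa * s).
  by apply: semigroup_scale => //; rewrite mulr_ege1 // ler1n.
have [k Sk hk] := semigroup_add _ hS1 _ _ Sh SN.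
have scale2 : S1 (fun x => 2 * x) by apply: semigroup_scale; rewrite // ler1n.
(* This dominates [2 * (h s + tau)], the scale at which the union step needs the neighborhoods [A w]
   colored. *)
pose rho1 := fun s => 2 * k s.
have Srho1 : S1 rho1 by exact: semigroup_comp scale2 Sk.
pose G := fun s => gY (g (K * s)).
have SK : S2 (fun s => K * s) by exact: semigroup_scale.
have SgK : S2 (fun s => g (K * s)) by exact: semigroup_comp Sg SK.
have SG : S2 G by exact: semigroup_comp SgY SgK.
(* Three terms bound the image of a neighborhood [A w]: one piece of [Y], and the displacement
   [g (K * s) <= G s] at either end. *)
pose delta := fun s => 3 * G s.
have Sdelta : S2 delta.
  apply: (semigroup_comp _ hS2 (fun x => 3 * x)) SG.
  by apply: semigroup_scale; rewrite // ler1n.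
have [[D0 /(_ _ _ Srho1 Sdelta)[rho2 Srho2 Drho2]] /near2_pinftyW[M DM]] := fD.
(* The sum dominates the diameter bound [D' + 2 * h s + tau] of the union step. *)
have [l Sl kl] := semigroup_add _ hS1 _ _ Srho2 (semigroup_comp _ hS1 _ _ scale2 Sk).
exists l => //; near=> s.
have s0 : 0 <= s by near: s; exact: nbhs_pinfty_ge.
have [bc bD] : (forall x y, c s x = c s y -> mdist x y <= g (K * s) -> b s x = b s y) /\
  (forall x y, c s x = c s y -> b s x = b s y -> mdist x y <= G s) by near: s.
have ks0 : 0 <= kappa * s by rewrite mulr_ge0.
have hs0 : 0 <= h s by exact: semigroup_ge0 Sh s0.
have hks : h s + N.+1%:R * kappa * s <= k s by near: s.
have lP : rho2 s + 2 * k s <= l s by near: s.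
have Drho : D (rho1 s) (delta s) <= rho2 s by near: s.
have gG : g (K * s) <= G s.
  by near: s; exact: (semigroup_near S2 hS2 _ _ SgK (semigroup_ge _ hS2 _ SgY)).
have fgs : forall x y : X, mdist x y <= K * s -> mdist (f x) (f y) <= g (K * s).
  by near: s; exact: (semigroup_near S2 hS2 _ _ SK fg).
have rM : M < rho1 s.
  near: s; apply: (semigroup_near S1 hS1 _ (fun x => M < x) Srho1).
  by apply: nbhs_pinfty_gt; exact: num_real.
have dM : M < delta s.
  near: s; apply: (semigroup_near S2 hS2 _ (fun x => M < x) Sdelta).
  by apply: nbhs_pinfty_gt; exact: num_real.
pose tau := N.+1%:R * (kappa * s).
pose t := (2 * N.+1)%:R * tau.
(* This is where [C] comes from: [2 * t] equals [4 * N.+1 ^ 2 * (kappa * s)], and [N <= m + n]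
   because [j <= n]. *)
have NC : (2 * (2 * N.+1) * N.+1)%:R <= C.
  rewrite /C ler_nat (mulnA 2 2) -mulnA leq_mul2l -mulnn leq_mul //=.
    by rewrite ltnS leq_add2l.
  by rewrite ltnS leq_add2l.
have CE : kappa * C * s = C * (kappa * s) by rewrite mulrAC mulrC.
have tK : 2 * t <= K * s.
  apply: (@le_trans _ _ (kappa * C * s)); last by rewrite ler_wpM2r.
  by rewrite CE /t /tau 2!mulrA -!natrM ler_wpM2r.
have tau0 : 0 <= tau by rewrite mulr_ge0.
have t0 : 0 <= t by rewrite mulr_ge0.
have k_hs : h s + tau <= k s by rewrite /tau mulrA.
rewrite addnS.
apply: (@colorableW _ _ _ _ (D (rho1 s) (delta s) + 2 * h s + tau) _
  ([set x | (c s (f x) < j)%N] `|` [set x | c s (f x) = j])).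
- by move=> x /=; rewrite ltnS leq_eqVlt => /orP[/eqP|]; [right|left].
- lra.
(* The class of color [j] is split according to the pieces of [Y]; the control function of [f] gives
   [m.+1] colors near each part. *)
apply: (@colorable_union _ _ _ _ _ (fun x => b s (f x)) _ m.+1 _
  (kappa * C * s) _ (rho1 s)) => //.
- apply: D0; rewrite mulr_ge0 //; first by rewrite (le_trans _ k_hs) // addr_ge0.
  by rewrite (le_trans _ gG) // (semigroup_ge0 _ hS2 _ _ SgK).
- by rewrite ltnS leq_addr.
- rewrite CE mulrA -natrM ler_wpM2r // (le_trans _ NC) // ler_nat.
  by rewrite leq_mul2r leq_pmulr ?orbT.
- by rewrite ler_wpM2l.
- by near: s.
- move=> x y /= cx cy xy; apply: bc; first by rewrite cx cy.
  by apply: fgs; exact: le_trans tK.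
- move=> w; have [|B [AB BD]] := DM _ _ rM dM
      [set x | exists q, [/\ c s (f q) = j, b s (f q) = w & mdist x q <= t]].
    move=> x y [p [cp bp xp]] [q [cq bq yq]].
    have := bD (f p) (f q); rewrite cp cq bp bq => /(_ erefl erefl).
    have tK' : t <= K * s by lra.
    have := fgs _ _ (le_trans xp tK'); have := fgs _ _ (le_trans yq tK').
    rewrite /delta (metric_sym (f y)).
    have := metric_triangle (f x) (f p) (f y).
    have := metric_triangle (f p) (f q) (f y); lra.
  exact: colorable_of_components AB BD.
Unshelve. all: by end_near.
Qed.

End fibered_coloring.

(** * The dimension inequality *)

Lemma asdim_le_add {R : realType} (S1 S2 : set (R -> R))
    (hS1 : control_semigroup S1) (hS2 : control_semigroup S2)
    (X Y : metricType R) (f : X -> Y) (m n : nat) (D : R -> R -> R) :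
  Sigma_coarse f S2 -> map_control_function f S1 S2 m D -> asdim_le Y S2 n ->
  asdim_le X S1 (m + n).
Proof.
move=> /Sigma_coarse_bound[g Sg fg] fD [gY SgY Yn].
pose C : R := (4 * (m + n).+1 ^ 2)%:R.
(* The power of [C] pays for [n.+1] induction steps; the factor 2 leaves a final scale [2 * s],
   strictly above [s]. *)
pose K := 2 * C ^+ n.+1.
have C1 : 1 <= C by rewrite ler1n muln_gt0 expn_gt0.
have K1 : 1 <= K by rewrite mulr_ege1 ?exprn_ege1 // ler1n.
have SgK : S2 (fun s => g (K * s)).
  by apply: (semigroup_comp _ hS2) => //; exact: semigroup_scale.
(* A coloring of [Y] is chosen for every [s], with junk values where none exists; by [cbK] this does
   not occur for large [s]. *)
have /choice[cb cbP] : forall s, exists cb : (Y -> nat) * (Y -> set Y),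
    colorable n.+1 (g (K * s)) (gY (g (K * s))) [set: Y] ->
    [/\ forall y, (cb.1 y < n.+1)%N,
        forall x y, cb.1 x = cb.1 y -> mdist x y <= g (K * s) -> cb.2 x = cb.2 y &
        forall x y, cb.1 x = cb.1 y -> cb.2 x = cb.2 y -> mdist x y <= gY (g (K * s))].
  move=> s; have [[c [b [cn bc bD]]]|no] 
      := pselect (colorable n.+1 (g (K * s)) (gY (g (K * s))) [set: Y]); last first.
    by exists (fun=> 0%N, fun=> set0).
  exists (c, b) => _; split=> [y|x y|x y] /=; first exact: cn.
    exact: bc.
  exact: bD.
have cbK : \forall s \near +oo, colorable n.+1 (g (K * s)) (gY (g (K * s))) [set: Y].
  apply: (semigroup_near _ hS2 _ (fun s => colorable n.+1 s (gY s) [set: Y]) SgK).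
  apply: filterS Yn => s [F [cover FP]]; exact: colorable_of_families cover FP.
have [||h Sh hP] := colorable_preimage S1 S2 hS1 hS2 f m n D fD g gY Sg SgY fg K
    (fun s => (cb s).1) (fun s => (cb s).2) K1 _ n.+1 2 (leqnn _) _ (lexx _).
- by apply: filterS cbK => s /cbP[].
- by rewrite ler1n.
exists h => //; near=> s.
apply: (@families_of_colorable _ _ (m + n).+1 _ (2 * s)).
  by rewrite ltr_pMl ?ltr1n //; near: s; exact: nbhs_pinfty_gt.
rewrite -addnS (_ : [set: X] = [set x | ((cb s).1 (f x) < n.+1)%N]); first by near: s.
apply/seteqP; split=> // x _ /=.
have /cbP[+ _ _] : colorable n.+1 (g (K * s)) (gY (g (K * s))) [set: Y] by near: s.
exact.
Unshelve. all: by end_near.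
Qed.

Theorem theorem7p8 (R : realType) (S1 S2 : set (R -> R))
    (hS1 : control_semigroup S1) (hS2 : control_semigroup S2)
    (X Y : metricType R) (f : X -> Y) (hf : Sigma_coarse f S2) :
  (asdim X S1 <= asdim_map f S1 S2 + asdim Y S2)%E.
Proof.
rewrite /asdim /asdim_map.
(* If either dimension on the right is infinite, so is the sum, since neither can be [-oo]. *)
have [[m [D fD] ->]|->] := @least_natP R (fun m => exists D, map_control_function f S1 S2 m D);
  have [[n Yn ->]|->] := @least_natP R (asdim_le Y S2); rewrite ?addye ?addey ?leey //.
rewrite -EFinD -natrD; apply: least_nat_le.
exact: asdim_le_add hf fD Yn.
Qed.
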